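(* Let $A,\nu\ge0$. Let $X$ and $Z$ be (real-valued) random variables satisfying $|X|\le A$ almost surely and $\mathrm{Var}(Z)\le\nu$. Then $$h(X+Z)\le \ell(\nu),$$ where $$\ell(\nu)=\limsup_{n\to\infty}\frac1n\log\mathrm{Vol}\left([-A,A]^n\oplus B_n(\sqrt{n\nu})\right).$$
   Context: Logarithms are natural, $\log 0=-\infty$. $h$ denotes differential entropy in nats (with $h=-\infty$ for a random variable without a density). $B_n(r)$ is the closed Euclidean ball of radius $r$ in $\mathbb R^n$ centered at the origin, $\oplus$ denotes Minkowski sum, and $\mathrm{Vol}$ is $n$-dimensional Lebesgue measure. *)

(* Defs.v *)
From HB Require Import structures.
From mathcomp Require Import all_boot all_order all_algebra.
From mathcomp Require Import all_classical all_reals all_analysis.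
From mathcomp Require Import measurable_realfun.
Set Implicit Arguments.
Unset Strict Implicit.
Unset Printing Implicit Defensive.
Import Order.TTheory GRing.Theory Num.Theory.
Import numFieldNormedType.Exports.
Local Open Scope classical_set_scope.
Local Open Scope ring_scope.

(* Lebesgue measure on R^n is the n-fold iterated product of [lebesgue_measure].
   The carrier is [measurableTypeR R], the type on which the library declares
   [lebesgue_measure]: it has the same measurable sets as [R], but a different
   display. *)
Section lebesgue_cons.
Context {R : realType} (n : nat).
Variable m : {sigma_finite_measure set n.-tuple (measurableTypeR R) -> \bar R}.

Definition tcons (p : measurableTypeR R * n.-tuple (measurableTypeR R)) :
    n.+1.-tuple (measurableTypeR R) :=
  [the n.+1.-tuple (measurableTypeR R) of p.1 :: p.2].

Lemma measurable_tcons :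
  measurable_fun [set: measurableTypeR R * n.-tuple (measurableTypeR R)] tcons.
Proof. exact: measurable_cons. Qed.

Definition lebesgue_cons : set (n.+1.-tuple (measurableTypeR R)) -> \bar R :=
  pushforward (@lebesgue_measure R \x m)%E tcons.

Let lebesgue_cons0 : lebesgue_cons set0 = 0%E.
Proof. by rewrite /lebesgue_cons /pushforward preimage_set0 measure0. Qed.

Let lebesgue_cons_ge0 S : (0 <= lebesgue_cons S)%E.
Proof. by apply: integral_ge0 => x _; exact: measure_ge0. Qed.

Let lebesgue_cons_semi_sigma_additive : semi_sigma_additive lebesgue_cons.
Proof.
by apply: measure_semi_sigma_additive; exact: measurable_tcons.
Qed.

HB.instance Definition _ := isMeasure.Build _ _ _ lebesgue_cons
  lebesgue_cons0 lebesgue_cons_ge0 lebesgue_cons_semi_sigma_additive.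

Lemma lebesgue_consX (A : set (measurableTypeR R))
    (B : set (n.-tuple (measurableTypeR R))) :
  measurable A -> measurable B ->
  lebesgue_cons [set t | A (thead t) /\ B [tuple of behead t]] =
  (@lebesgue_measure R A * m B)%E.
Proof.
move=> mA mB; rewrite -product_measure1E//.
rewrite /lebesgue_cons /pushforward; congr (_ _).
apply/seteqP; split => -[x y] /=; rewrite theadE (_ : [tuple of _] = y)//.
  exact: val_inj.
exact: val_inj.
Qed.

Lemma sigma_finite_lebesgue_cons : sigma_finite setT lebesgue_cons.
Proof.
have /sigma_finiteP[F [TF ndF Foo]] := sigma_finiteT (@lebesgue_measure R).
have /sigma_finiteP[G [TG ndG Goo]] := sigma_finiteT m.
exists (fun k => [set t | F k (thead t) /\ G k [tuple of behead t]]).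
  apply/seteqP; split => // t _.
  have [i _ Fi] : (\bigcup_k F k) (thead t) by rewrite -TF.
  have [j _ Gj] : (\bigcup_k G k) [tuple of behead t] by rewrite -TG.
  exists (maxn i j) => //; split.
    by move: Fi; apply/subsetPset/ndF/leq_maxl.
  by move: Gj; apply/subsetPset/ndG/leq_maxr.
move=> k; have [mF Fk] := Foo k; have [mG Gk] := Goo k; split.
  apply: (@measurableI _ _ (@thead _ _ @^-1` F k)
    ((fun t : n.+1.-tuple (measurableTypeR R) => [tuple of behead t])
       @^-1` G k)); rewrite -[X in measurable X]setTI.
    exact: measurable_tnth.
  exact: measurable_behead.
by rewrite lebesgue_consX// lte_mul_pinfty// ge0_fin_numE.
Qed.

HB.instance Definition _ := @Measure_isSigmaFinite.Build _ _ _
  lebesgue_cons sigma_finite_lebesgue_cons.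

End lebesgue_cons.

Fixpoint lebesgue_tuple {R : realType} (n : nat) :
    {sigma_finite_measure set n.-tuple (measurableTypeR R) -> \bar R} :=
  match n with
  | 0 => \d_([tuple] : 0.-tuple (measurableTypeR R))
  | n'.+1 => lebesgue_cons (lebesgue_tuple n')
  end.

Lemma lebesgue_tuple_box {R : realType} n
    (A : 'I_n -> set (measurableTypeR R)) :
  (forall i, measurable (A i)) ->
  lebesgue_tuple n [set t | forall i, A i (tnth t i)] =
  (\prod_(i < n) @lebesgue_measure R (A i))%E.
Proof.
elim: n A => [|n IHn] A mA.
  by rewrite big_ord0 /= diracE mem_set//= => -[].
rewrite big_ord_recl -IHn// -lebesgue_consX//; last first.
  rewrite [X in measurable X](_ : _ = \bigcap_(i in [set: 'I_n])
    ((fun t => tnth t i) @^-1` A (lift ord0 i))); last first.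
    by apply/seteqP; split => t /= h i; [move=> _|]; exact: h.
  apply: fin_bigcap_measurable => // i _.
  by rewrite -[X in measurable X]setTI; exact: measurable_tnth.
congr (lebesgue_cons _ _); apply/seteqP; split => t /=.
  move=> At; split; first exact: At.
  by move=> i; have := At (lift ord0 i); rewrite {1}(tuple_eta t) tnthS.
move=> [At0 At] i; have [->//|i0] := eqVneq i ord0.
have [j ->] : exists j, i = lift ord0 j.
  by case: (unliftP ord0 i) i0 => [j ->|->]; [exists j | rewrite eqxx].
by rewrite (tuple_eta t) tnthS; exact: At.
Qed.

(* The Lebesgue measure above lives on tuples, whereas Minkowski sums need the
   vector space structure of row vectors: [S] is transported along the
   coordinate bijection. *)
Definition Vol {R : realType} (n : nat) (S : set 'rV[R]_n) : \bar R :=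
  lebesgue_tuple n [set t | S (\row_i tnth t i)].

Definition cube {R : realType} (n : nat) (A : R) : set 'rV[R]_n :=
  [set x | forall i, x 0 i \in `[- A, A]].

(* [`|x|] on ['rV[R]_n] is the sup norm, hence the explicit Euclidean norm. *)
Definition eball {R : realType} (n : nat) (r : R) : set 'rV[R]_n :=
  [set x | Num.sqrt (\sum_i x 0 i ^+ 2) <= r].

Definition minkowski {R : realType} (n : nat) (S S' : set 'rV[R]_n) :
  set 'rV[R]_n := [set x + y | x in S & y in S'].

(* [lne 0 = -oo]; the term of index 0 does not affect the limit superior. *)
Definition ell {R : realType} (A nu : R) : \bar R :=
  limn_esup (fun n : nat =>
    (n%:R^-1)%:E *
    lne (Vol (minkowski (@cube R n A) (@eball R n (Num.sqrt (n%:R * nu))))))%E.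

Definition is_density {d} {T : measurableType d} {R : realType}
    (P : probability T R) (X : {RV P >-> R}) (f : R -> R) : Prop :=
  [/\ measurable_fun setT f, forall x, 0 <= f x &
      forall S : set R, measurable S ->
        distribution P X S = (\int[lebesgue_measure]_(x in S) (f x)%:E)%E].

(* Two densities of X agree almost everywhere, so the choice of [f] is
   immaterial. [ln 0 = 0], which gives the usual convention 0 log 0 = 0. *)
Definition diff_entropy {d} {T : measurableType d} {R : realType}
    (P : probability T R) (X : {RV P >-> R}) : \bar R :=
  match pselect (exists f, is_density X f) with
  | left Xf =>
    let f := sval (cid Xf) in
    (- \int[lebesgue_measure]_x (f x * ln (f x))%:E)%E
  | right _ => -oo%E
  end.

(* Main.v *)
(** With e(x) = max(|x| - A, 0), the set [-A,A]^n + B_n(sqrt(n nu)) is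
    {t | sum_i e(t_i)^2 <= n nu}, and |X| <= A gives E[e(X + Z - E Z)^2] <= nu.
    For s > 0 the weight exp(-e^2/s^2) has mass W(s) = 2A + s sqrt(pi), so Gibbs'
    inequality yields h(X + Z) <= ln W(s) + nu/s^2 for every s.  Conversely, let s
    be such that e^2 has mean m under the normalized weight.  A Chernoff bound in both
    directions, i.e. comparing the n-fold product of the weight at s with those at
    s(1 + eps/2) and s(1 - eps/2), shows that the product weight concentrates on
    n m (1 - eps) <= sum_i e(t_i)^2 <= n m (1 + eps), where it is at most
    exp(-n m (1 - eps)/s^2).  Hence ell(m (1 + eps)) >= ln W(s) + m (1 - eps)/s^2 - eps,
    and taking m = nu/(1 + eps), eps -> 0 closes the gap because s^2 >= 2m. *)
From HB Require Import structures.
Require Import Defs.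
From mathcomp Require Import all_boot all_order all_algebra.
From mathcomp Require Import all_classical all_reals all_analysis.
From mathcomp Require Import measurable_realfun ring lra.
Import Order.TTheory GRing.Theory Num.Theory.
Import numFieldNormedType.Exports.
Local Open Scope classical_set_scope.
Local Open Scope ring_scope.
Set Implicit Arguments.
Unset Strict Implicit.

(** * Distance to the interval and the weight with Gaussian tails *)

Section excess.
Context {R : realType}.
Implicit Types A s c x : R.

(** For [0 <= A], the distance from [x] to the interval $[-A,A]$. *)
Definition excess A x : R := Num.max (`|x| - A) 0.

Lemma excess_ge0 A x : 0 <= excess A x.
Proof. by rewrite le_max lexx orbT. Qed.

Lemma continuous_excess A : continuous (excess A).
Proof.
move=> x; apply: (@continuous_max R R^o (fun x => `|x| - A) (cst 0)).
  by apply: cvgB; [exact: norm_continuous|exact: cvg_cst].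
exact: cvg_cst.
Qed.

(** An exponential family with statistic [excess A x ^+ 2] and natural parameter [- s ^- 2]: flat on
    the interval, Gaussian outside. *)
Definition weight A s x : R := expR (- (excess A x / s) ^+ 2).

Lemma weight_ge0 A s x : 0 <= weight A s x.
Proof. exact: expR_ge0. Qed.

Lemma continuous_weight A s c : continuous (fun x => weight A s (x - c)).
Proof.
move=> x; apply: (@continuous_comp _ _ _ (fun x => excess A (x - c) / s)
   (fun y => expR (- y ^+ 2))).
  apply: cvgM; last exact: cvg_cst.
  apply: (@continuous_comp _ _ _ (fun x => x - c) (excess A)).
    by apply: cvgB; [exact: cvg_id|exact: cvg_cst].
  exact: continuous_excess.
exact: continuous_gauss_fun.
Qed.

Lemma measurable_excess A : measurable_fun [set: R] (excess A).
Proof. by apply: continuous_measurable_fun; exact: continuous_excess. Qed.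

Lemma measurable_weight A s c :
  measurable_fun [set: R] (fun x => weight A s (x - c)).
Proof. by apply: continuous_measurable_fun; exact: continuous_weight. Qed.

(** Length of the interval plus the mass of two half-Gaussian tails. It is affine in [s], which
    makes later changes of scale exact. *)
Definition weight_mass A s : R := 2 * A + s * Num.sqrt pi.

Lemma weight_mass_gt0 A s : 0 <= A -> 0 < s -> 0 < weight_mass A s.
Proof.
by move=> A0 s0; rewrite ltr_wpDl ?mulr_ge0// mulr_gt0// sqrtr_gt0 pi_gt0.
Qed.

(** The substitution [x = s * u + (c + A)] turns the right tail into the Gaussian integral over a
    half-line. *)
Lemma integral_weight_right A s c : 0 <= A -> 0 < s ->
  (\int[lebesgue_measure]_(x in `[(c + A)%R, +oo[) (weight A s (x - c))%:E =
  (s * (Num.sqrt pi / 2))%:E)%E.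
Proof.
move=> A0 s0.
pose F (x : R^o) : R^o := s * x + (c + A).
have dF (x : R) : is_derive (x : R^o) 1 F s.
  have : is_derive (x : R^o) 1 ((s \*: (@idfun R^o)) + cst (c + A)) (s *: 1 + 0).
    exact: is_deriveD.
  by rewrite addr0 /GRing.scale/= mulr1.
have F'E : F^`()%classic = cst s.
  by apply/funext => x; rewrite derive1E derive_val.
have F0 : F 0 = c + A by rewrite /F mulr0 add0r.
rewrite -F0 (@increasing_ge0_integration_by_substitutiony _ F); first last.
- by move=> x _; exact: weight_ge0.
- by apply: continuous_subspaceT; exact: continuous_weight.
- apply: (cvg_comp (fun x => s * x) (fun x => x + (c + A))).
    by apply: gt0_cvgMry => //; exact: cvg_id.
  exact: cvg_addrr.
- split; first by move=> x _; have [] := dF x.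
  apply: cvg_at_right_filter; apply: differentiable_continuous.
  by apply/derivable1_diffP; have [] := dF 0.
- by rewrite F'E; exact: is_cvg_cst.
- by rewrite F'E; exact: is_cvg_cst.
- by rewrite F'E => ? _; exact: cvg_cst.
- by move=> x y _ _ xy; rewrite /F ltrD2r ltr_pM2l.
rewrite EFinM -integral0y_gauss -ge0_integralZl_EFin//=; last 3 first.
- by move=> x _; rewrite lee_fin gauss_fun_ge0.
- apply/measurable_EFinP/measurable_funTS; exact: measurable_gauss_fun.
- exact: ltW.
apply: eq_integral => x; rewrite inE/= in_itv/= andbT => x0.
rewrite F'E -EFinM mulrC /=; congr (_ * expR (- _ ^+ 2))%:E.
rewrite /F /excess (_ : _ - c = s * x + A); last by ring.
rewrite ger0_norm ?addr_ge0 ?mulr_ge0 ?(ltW s0)// addrK max_l ?mulr_ge0 ?(ltW s0)//.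
by rewrite mulrAC divff ?mul1r// gt_eqF.
Qed.

(** Reflecting [x] to [- x] gives the right tail centred at [- c]. *)
Lemma integral_weight_left A s c : 0 <= A -> 0 < s ->
  (\int[lebesgue_measure]_(x in `]-oo, (c - A)%R]) (weight A s (x - c))%:E =
  (s * (Num.sqrt pi / 2))%:E)%E.
Proof.
move=> A0 s0; rewrite -(integral_weight_right (- c) A0 s0).
rewrite (_ : c - A = - (- c + A)); last by rewrite opprD opprK.
rewrite ge0_integration_by_substitutionNy//.
- apply: eq_integral => x _ /=; congr (expR (- (Num.max (_ - A) 0 / s) ^+ 2))%:E.
  by rewrite opprK -normrN opprB opprK addrC.
- by apply: continuous_subspaceT; exact: continuous_weight.
- by move=> x _; exact: weight_ge0.
Qed.

Lemma integral_weight A s c : 0 <= A -> 0 < s ->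
  (\int[lebesgue_measure]_x (weight A s (x - c))%:E = (weight_mass A s)%:E)%E.
Proof.
move=> A0 s0.
have mw (D : set R) : measurable_fun D (fun x => (weight A s (x - c))%:E).
  by apply/measurable_funTS/measurable_EFinP; exact: measurable_weight.
have TE : [set: R] =
    `]-oo, (c - A)%R] `|` (`](c - A)%R, (c + A)%R] `|` `](c + A)%R, +oo[).
  apply/seteqP; split => // x _ /=; rewrite !in_itv/= andbT.
  by case: (leP x (c - A)) => h1; case: (leP x (c + A)) => h2; auto.
rewrite TE ge0_integral_setU//=; last 4 first.
- exact: measurableU.
- exact: mw.
- by move=> x _; rewrite lee_fin weight_ge0.
- rewrite disj_set2E; apply/eqP; rewrite -subset0 => x []/=.
  by rewrite !in_itv/= andbT => h1 [/andP[h2 h3]|h2]; lra.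
rewrite ge0_integral_setU//=; last 3 first.
- exact: mw.
- by move=> x _; rewrite lee_fin weight_ge0.
- rewrite disj_set2E; apply/eqP; rewrite -subset0 => x []/=.
  by rewrite !in_itv/= andbT => /andP[h1 h2] h3; lra.
rewrite integral_weight_left// [X in (_ + (_ + X))%E]integral_itv_obnd_cbnd//
  integral_weight_right//.
rewrite (_ : integral _ _ _ = (2 * A)%:E).
  by rewrite -!EFinD; congr EFin; rewrite /weight_mass; field.
transitivity (\int[lebesgue_measure]_(x in `](c - A)%R, (c + A)%R]) (cst 1%:E (x : R)))%E.
  apply: eq_integral => x; rewrite inE/= in_itv/= => /andP[h1 h2].
  rewrite /weight /excess max_r ?mul0r ?expr0n ?oppr0 ?expR0//.
  by rewrite subr_le0 ler_norml; lra.
rewrite integral_cst//= mul1e lebesgue_measure_itv/= lte_fin; case: ltP => h.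
  by rewrite -EFinD; congr EFin; ring.
(* Here [h] forces [A = 0], so the empty middle interval still has length [2 * A]. *)
by congr EFin; lra.
Qed.

End excess.

(** * Densities and Gibbs' inequality *)

Section density.
Context {d} {T : measurableType d} {R : realType} (P : probability T R).
Variable Y : {RV P >-> R}.

(** The Radon-Nikodym derivative of the law of [Y] has the same integrals as [f] over measurable
    sets, so the two agree almost everywhere and the change of variables carries over to [f]. *)
Lemma integral_density (f k : R -> R) : is_density Y f ->
  measurable_fun setT k -> (forall x, 0 <= k x) ->
  (\int[P]_w (k (Y w))%:E = \int[lebesgue_measure]_x (k x * f x)%:E)%E.
Proof.
move=> [mf f0 fY] mk k0.
(* [Y] is retyped so that its law and [lebesgue_measure] live on the same measurable type. *)
have mY' : measurable_fun [set: T] (Y : T -> measurableTypeR R).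
  exact: (@measurable_funPT _ _ _ _ Y).
pose Y' : {RV P >-> measurableTypeR R} := HB.pack (Y : T -> measurableTypeR R)
  (isMeasurableFun.Build _ _ _ _ _ mY').
pose nu : {finite_measure set (measurableTypeR R) -> \bar R} := distribution P Y'.
have nuE S : measurable S -> nu S = (\int[lebesgue_measure]_(x in S) (f x)%:E)%E.
  exact: fY.
have numu : nu `<< (@lebesgue_measure R).
  apply/null_content_dominatesP => S mS S0; rewrite nuE// null_set_integral//.
  exact/measurable_funTS/measurable_EFinP.
have mT : measurable [set: measurableTypeR R] by [].
have mkE : measurable_fun [set: measurableTypeR R] (EFin \o k).
  exact/measurable_EFinP.
transitivity (\int[nu]_x (k x)%:E)%E.
  by rewrite ge0_integral_distribution.
rewrite -(Radon_Nikodym_SigmaFinite.change_of_variables numu)//.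
have /measurable_int mg := Radon_Nikodym_SigmaFinite.f_integrable numu.
apply: ae_eq_integral => //.
- exact: emeasurable_funM.
- exact/measurable_EFinP/measurable_funM.
under [X in ae_eq _ _ _ X]eq_fun do rewrite EFinM.
apply: ae_eqe_mul2l; apply: integral_ae_eq => //.
- exact: Radon_Nikodym_SigmaFinite.f_integrable.
- exact/measurable_EFinP.
- move=> E _ mE; rewrite -nuE//; symmetry.
  exact: (Radon_Nikodym_SigmaFinite.f_integral numu mE).
Qed.

(* Unlike [le_integral], this does not assume integrability: [f ln f] may have
   integral [+oo]. *)
Lemma le_integral_measurable {d'} {T' : measurableType d'}
    (mu : {measure set T' -> \bar R}) (g h : T' -> \bar R) :
  measurable_fun setT g -> measurable_fun setT h -> (forall x, g x <= h x)%E ->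
  (\int[mu]_x g x <= \int[mu]_x h x)%E.
Proof.
move=> mg mh gh; rewrite integralE [leRHS]integralE; apply: leeB.
  apply: ge0_le_integral => //; [exact: measurable_funepos..|].
  move=> x _; apply: (@funepos_le _ _ setT) => [y _|]; first exact: gh.
  by rewrite inE.
apply: ge0_le_integral => //; [exact: measurable_funeneg..|].
move=> x _; apply: (@funeneg_le _ _ setT) => [y _|]; first exact: gh.
  by rewrite inE.
Qed.

(** Gibbs' inequality against the normalized weight [g] centred at [c]: [- ln (g x)] is
    [ln Z + k x], and [k] has mean at most [nu / s ^+ 2] under [f]. *)
Lemma entropy_le_weight (f : R -> R) (A s c nu : R) :
  0 <= A -> 0 < s -> is_density Y f ->
  (\int[P]_w (excess A (Y w - c) ^+ 2)%:E <= nu%:E)%E ->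
  (- (\int[lebesgue_measure]_x (f x * ln (f x))%:E) <=
    (ln (weight_mass A s) + nu / s ^+ 2)%:E)%E.
Proof.
move=> A0 s0 fY; have [mf f0 fYE] := fY => hnu.
have Z0 := weight_mass_gt0 A0 s0; set Z := weight_mass A s in Z0 *.
pose k x := (excess A (x - c) / s) ^+ 2.
have k0 x : 0 <= k x by exact: sqr_ge0.
have mexc : measurable_fun setT (fun x : R => excess A (x - c)).
  apply: measurableT_comp; first exact: measurable_excess.
  exact: measurable_funB.
have mk : measurable_fun setT k by apply: measurable_funX; exact: measurable_funM.
pose g x := Z^-1 * weight A s (x - c).
have g0 x : 0 <= g x by rewrite mulr_ge0 ?weight_ge0// invr_ge0 ltW.
have mg : measurable_fun setT g.
  by apply: measurable_funM => //; exact: measurable_weight.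
have mT : measurable [set: measurableTypeR R] by [].
have intf : (\int[lebesgue_measure]_x (f x)%:E = 1)%E.
  by rewrite -fYE//; exact: probability_setT.
have intg : (\int[lebesgue_measure]_x (g x)%:E = 1)%E.
  under eq_integral do rewrite EFinM.
  rewrite ge0_integralZl_EFin//.
  - by rewrite integral_weight// -EFinM mulVf// gt_eqF.
  - by move=> x _; rewrite lee_fin weight_ge0.
  - by apply/measurable_EFinP; exact: measurable_weight.
  - by rewrite invr_ge0 ltW.
have intk : (\int[lebesgue_measure]_x (k x * f x)%:E <= (nu / s ^+ 2)%:E)%E.
  rewrite -(integral_density fY)//.
  under eq_integral do rewrite /k expr_div_n mulrC EFinM.
  rewrite ge0_integralZl_EFin//.
  - by rewrite mulrC EFinM lee_wpmul2l// lee_fin invr_ge0 sqr_ge0.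
  - by move=> x _; rewrite lee_fin sqr_ge0.
  - apply/measurable_EFinP/measurable_funX.
    exact: (measurableT_comp mexc).
  - by rewrite invr_ge0 sqr_ge0.
have If : lebesgue_measure.-integrable setT (EFin \o f).
  apply/integrableP; split; first exact/measurable_EFinP.
  under eq_integral do rewrite /= ger0_norm//.
  by rewrite intf ltry.
have Ig : lebesgue_measure.-integrable setT (EFin \o g).
  apply/integrableP; split; first exact/measurable_EFinP.
  under eq_integral do rewrite /= ger0_norm//.
  by rewrite intg ltry.
have kf0 x : 0 <= k x * f x by exact: mulr_ge0.
have Ik : lebesgue_measure.-integrable setT (EFin \o (fun x => k x * f x)).
  apply/integrableP; split; first exact/measurable_EFinP/measurable_funM.
  under eq_integral do rewrite /= (ger0_norm (kf0 _)).
  exact: (le_lt_trans intk (ltry _)).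
(* [r = f ln g + f - g], which Gibbs' inequality bounds by [f ln f]. *)
pose r x := (1 - ln Z) * f x - (k x * f x + g x).
have rE : (\int[lebesgue_measure]_x (r x)%:E =
    (1 - ln Z)%:E - (\int[lebesgue_measure]_x (k x * f x)%:E + 1))%E.
  under eq_integral do rewrite EFinB.
  rewrite integralB_EFin//; last 2 first.
  - exact: (integrableZl mT (1 - ln Z) If).
  - exact: (integrableD _ Ik Ig).
  rewrite (integralD_EFin mT Ik Ig) intg.
  under eq_integral do rewrite EFinM.
  by rewrite integralZl// intf mule1.
have rf x : r x <= f x * ln (f x).
  (* Where [f] vanishes, [f x * ln (f x)] is 0 while [r x = - g x]. *)
  have [fx0|fx0] := eqVneq (f x) 0.
    by rewrite /r fx0 !(mulr0, mul0r, add0r, sub0r) oppr_le0.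
  have {}fx0 : 0 < f x by rewrite lt_neqAle eq_sym fx0 f0.
  (* The inequality [1 + u <= expR u] at [u = ln (g x / f x)], multiplied by [f x]. *)
  have := expR_ge1Dx (- k x - ln Z - ln (f x)).
  rewrite !expRB !lnK ?posrE// -(@ler_pM2l _ (f x))// => h.
  have e : f x * (expR (- k x) / Z / f x) = g x.
    by rewrite /g /weight /k; field; rewrite !gt_eqF.
  by move: h; rewrite e /r; lra.
have -> : ln Z + nu / s ^+ 2 = - ((1 - ln Z) - (nu / s ^+ 2 + 1)) by ring.
rewrite EFinN EFinB (EFinD (nu / _)) leeN2.
apply: (@le_trans _ _ (\int[lebesgue_measure]_x (r x)%:E)%E).
  by rewrite rE leeB// leeD2r.
apply: le_integral_measurable.
- apply/measurable_EFinP/measurable_funB; first exact: measurable_funM.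
  by apply: measurable_funD => //; exact: measurable_funM.
- apply/measurable_EFinP/measurable_funM => //.
  by apply: measurableT_comp => //; exact: measurable_ln.
- by move=> x; rewrite lee_fin.
Qed.

End density.

(** * Product integrals over tuples *)

Section tuple_integral.
Context {R : realType}.

Lemma measurable_tuple_prod n (w : R -> R) : measurable_fun setT w ->
  measurable_fun [set: n.-tuple (measurableTypeR R)]
    (fun t => \prod_(i < n) w (tnth t i)).
Proof.
move=> mw; apply: measurable_prod => i _.
apply: (measurableT_comp (f := w : measurableTypeR R -> R)) => //.
exact: measurable_tnth.
Qed.

(** By induction, Tonelli's theorem splits off the head of the tuple; for [n = 0] the Dirac mass
    evaluates an empty product. *)
Lemma integral_tuple_prod n (w : R -> R) (z : R) : measurable_fun setT w ->
  (forall x, 0 <= w x) -> (\int[lebesgue_measure]_x (w x)%:E = z%:E)%E ->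
  (\int[lebesgue_tuple n]_t (\prod_(i < n) w (tnth t i))%:E = (z ^+ n)%:E)%E.
Proof.
move=> mw w0 wz.
have prod_ge0 m (t : m.-tuple (measurableTypeR R)) : 0 <= \prod_(i < m) w (tnth t i).
  by apply: prodr_ge0.
elim: n => [|n IHn].
  rewrite /= integral_dirac//; last first.
    apply/measurable_EFinP. exact: (measurable_tuple_prod mw).
  by rewrite diracT mul1e big_ord0 expr0.
transitivity (\int[pushforward (@lebesgue_measure R \x lebesgue_tuple n)%E (@tcons R n)]_t
    (\prod_(i < n.+1) w (tnth t i))%:E)%E.
  by [].
rewrite ge0_integral_pushforward//; first last.
- by move=> t _; rewrite lee_fin.
- apply/measurable_EFinP; exact: (measurable_tuple_prod mw).
- exact: measurable_tcons.
rewrite preimage_setT fubini_tonelli1/=; first last.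
- by move=> p; rewrite lee_fin; apply: prodr_ge0.
- apply: measurableT_comp; last exact: measurable_tcons.
  apply/measurable_EFinP. exact: (measurable_tuple_prod mw).
transitivity (\int[lebesgue_measure]_x ((z ^+ n)%:E * (w x)%:E))%E.
  apply: eq_integral => x _; rewrite /fubini_F.
  under eq_integral.
    move=> t _ /=.
    rewrite big_ord_recl (_ : tnth _ ord0 = x); last by rewrite (tnth_nth x).
    rewrite (eq_bigr (fun i => w (tnth t i))); last first.
      by move=> i _; rewrite !(tnth_nth x).
    rewrite EFinM; over.
  rewrite ge0_integralZl_EFin//.
  - by rewrite IHn muleC.
  - by move=> t _; rewrite lee_fin; apply: prodr_ge0.
  - apply/measurable_EFinP; exact: (measurable_tuple_prod mw).
rewrite ge0_integralZl_EFin//.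
- by rewrite wz -EFinM exprSr.
- by move=> x _; rewrite lee_fin.
- exact/measurable_EFinP.
- by apply: exprn_ge0; rewrite -lee_fin -wz integral_ge0// => x _; rewrite lee_fin.
Qed.

End tuple_integral.

(** * The Minkowski sum as a sublevel set, and the pointwise Chernoff bound *)

Section minkowski_volume.
Context {R : realType}.
Implicit Types A s a b nu : R.

(** The point [x] of the interval is at distance [|y|] from [x + y]. *)
Lemma excess_le_norm A x y : `|x| <= A -> excess A (x + y) <= `|y|.
Proof.
move=> xA; rewrite /excess ge_max normr_ge0 andbT lerBlDl.
by rewrite (le_trans (ler_normD _ _))// lerD2r.
Qed.

(** The witness is [x] minus its projection onto $[-A,A]$. *)
Lemma clip_excess A x : 0 <= A ->
  exists2 y, `|y| <= excess A x & `|x - y| <= A.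
Proof.
move=> A0; rewrite /excess; have [x0|x0] := leP 0 x.
  exists (Num.max (x - A) 0).
    by rewrite (ger0_norm x0) ger0_norm; last by rewrite le_max lexx orbT.
  by rewrite ler_norml; case: (leP (x - A) 0) => h; apply/andP; split; lra.
exists (- Num.max (- x - A) 0).
  by rewrite normrN (ltr0_norm x0) ger0_norm; last by rewrite le_max lexx orbT.
by rewrite ler_norml; case: (leP (- x - A) 0) => h; apply/andP; split; lra.
Qed.

Definition sublevel n A a : set (n.-tuple (measurableTypeR R)) :=
  [set t | \sum_(i < n) excess A (tnth t i) ^+ 2 <= n%:R * a].

(** The cube is a product, so projection onto it acts coordinatewise and the squared Euclidean
    distance to it is the sum of the squared excesses. *)
Lemma minkowski_cube_eballE n A nu : 0 <= A -> 0 <= nu ->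
  [set t : n.-tuple (measurableTypeR R) |
    Defs.minkowski (@cube R n A) (@eball R n (Num.sqrt (n%:R * nu)))
      (\row_i tnth t i)] = sublevel A nu.
Proof.
move=> A0 nu0; have nnu0 : 0 <= n%:R * nu by rewrite mulr_ge0.
apply/seteqP; split => t /=.
  move=> [x xA [y yr xy]]; rewrite /sublevel/=.
  move: yr; rewrite /eball/= ler_sqrt// => /(le_trans _); apply.
  apply: ler_sum => i _; rewrite -[leRHS]real_normK ?num_real//.
  rewrite lerXn2r ?nnegrE ?excess_ge0//.
  have -> : tnth t i = x 0 i + y 0 i by have /rowP/(_ i) := xy; rewrite !mxE.
  by apply: excess_le_norm; have := xA i; rewrite in_itv/= ler_norml.
move=> tS.
have /choice[y yP] : forall i, exists y, `|y| <= excess A (tnth t i) /\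
    `|tnth t i - y| <= A.
  by move=> i; have [y ? ?] := clip_excess (tnth t i) A0; exists y.
exists (\row_i (tnth t i - y i)).
  by move=> i; rewrite mxE in_itv/= -ler_norml; have [] := yP i.
exists (\row_i y i); last by apply/rowP => i; rewrite !mxE subrK.
rewrite /eball/= ler_sqrt//; apply: le_trans tS.
apply: ler_sum => i _; rewrite mxE -[leLHS]real_normK ?num_real//.
by rewrite lerXn2r ?nnegrE ?excess_ge0//; have [] := yP i.
Qed.

Lemma measurable_sublevel n A a : measurable (@sublevel n A a).
Proof.
have mS : measurable_fun [set: n.-tuple (measurableTypeR R)]
    (fun t => \sum_(i < n) excess A (tnth t i) ^+ 2).
  apply: measurable_sum => i; apply: measurable_funX.
  apply: (measurableT_comp (f := excess A : measurableTypeR R -> R)).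
    exact: measurable_excess.
  exact: measurable_tnth.
rewrite /sublevel -[X in measurable X]setTI.
have -> : [set t : n.-tuple (measurableTypeR R) |
    \sum_(i < n) excess A (tnth t i) ^+ 2 <= n%:R * a] =
  (fun t => \sum_(i < n) excess A (tnth t i) ^+ 2) @^-1` `]-oo, n%:R * a].
  by apply/seteqP; split => t /=; rewrite in_itv.
exact: mS.
Qed.

Lemma prod_weight n A s (t : n.-tuple (measurableTypeR R)) :
  \prod_(i < n) weight A s (tnth t i) =
  expR (- ((s ^+ 2)^-1 * \sum_(i < n) excess A (tnth t i) ^+ 2)).
Proof.
rewrite mulr_sumr -sumrN expR_sum; apply: eq_bigr => i _.
by rewrite /weight expr_div_n mulrC.
Qed.

(** Each term on the right suffices on one range of [S]: the first for [b <= S <= a], the second for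
    [S > a] because [(l - l1) * (S - a) >= 0], the third for [S < b] because
    [(l2 - l) * (b - S) >= 0]. *)
Lemma chernoff_pointwise (l l1 l2 S a b : R) : 0 <= l -> l1 <= l -> l <= l2 ->
  expR (- (l * S)) <= expR (- (l * b)) * (S <= a)%R%:R +
    expR (- ((l - l1) * a)) * expR (- (l1 * S)) +
    expR ((l2 - l) * b) * expR (- (l2 * S)).
Proof.
move=> l0 l1l ll2; rewrite -!expRD; have [Sa|aS] := leP S a; last first.
  rewrite mulr0 add0r (@le_trans _ _ (expR (- ((l - l1) * a) + - (l1 * S))))//.
    by rewrite ler_expR; nra.
  by rewrite lerDl expR_ge0.
rewrite mulr1; have [bS|Sb] := leP b S.
  rewrite -addrA (@le_trans _ _ (expR (- (l * b))))//.
    by rewrite ler_expR lerN2 ler_wpM2l.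
  by rewrite lerDl addr_ge0 ?expR_ge0.
rewrite (@le_trans _ _ (expR ((l2 - l) * b + - (l2 * S))))//.
  by rewrite ler_expR; nra.
by rewrite lerDr addr_ge0 ?expR_ge0.
Qed.

End minkowski_volume.

(** * The integrated Chernoff bound *)

Section volume_bound.
Context {R : realType}.
Implicit Types A s a b m e : R.

Lemma integral_tuple_weight n A s : 0 <= A -> 0 < s ->
  (\int[lebesgue_tuple n]_t (\prod_(i < n) weight A s (tnth t i))%:E =
  (weight_mass A s ^+ n)%:E)%E.
Proof.
move=> A0 s0.
have wE : weight A s = (fun x => weight A s (x - 0)).
  by apply/funext => x; rewrite subr0.
apply: integral_tuple_prod.
- by rewrite wE; exact: measurable_weight.
- by move=> x; exact: weight_ge0.
- by rewrite wE; exact: integral_weight.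
Qed.

(** Integrates [chernoff_pointwise] with the natural parameters [s ^- 2], [s1 ^- 2], [s2 ^- 2]. The
    volume is bounded below once the last two terms are small against the left side. *)
Lemma chernoff_volume n A s s1 s2 a b : 0 <= A -> 0 < s2 -> s2 <= s -> s <= s1 ->
  ((weight_mass A s ^+ n)%:E <=
   (expR (- (s ^- 2 * (n%:R * b))))%:E * lebesgue_tuple n (sublevel A a) +
   (expR (- ((s ^- 2 - s1 ^- 2) * (n%:R * a))) * weight_mass A s1 ^+ n)%:E +
   (expR ((s2 ^- 2 - s ^- 2) * (n%:R * b)) * weight_mass A s2 ^+ n)%:E)%E.
Proof.
move=> A0 s20 s2s ss1.
have s0 : 0 < s by exact: lt_le_trans s2s.
have s10 : 0 < s1 by exact: lt_le_trans ss1.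
set c0 := expR _; set c1 := expR _; set c2 := expR _.
have mw s' : measurable_fun [set: n.-tuple (measurableTypeR R)]
    (fun t => \prod_(i < n) weight A s' (tnth t i)).
  apply: measurable_tuple_prod; rewrite (_ : weight A s' = fun x => weight A s' (x - 0)).
    exact: measurable_weight.
  by apply/funext => x; rewrite subr0.
have w0 s' (t : n.-tuple (measurableTypeR R)) : 0 <= \prod_(i < n) weight A s' (tnth t i).
  by apply: prodr_ge0 => i _; exact: weight_ge0.
have mS := @measurable_sublevel R n A a.
rewrite -[in leLHS]integral_tuple_weight//.
rewrite !EFinM -!integral_tuple_weight//.
rewrite -(@setIT _ (sublevel A a)) -(integral_indic _ measurableT)//.
have mEw s' : measurable_fun [set: n.-tuple (measurableTypeR R)]
    (fun t => (\prod_(i < n) weight A s' (tnth t i))%:E).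
  exact/measurable_EFinP.
have Ew0 s' (t : n.-tuple (measurableTypeR R)) :
    setT t -> (0 <= (\prod_(i < n) weight A s' (tnth t i))%:E)%E.
  by rewrite lee_fin.
have mI : measurable_fun [set: n.-tuple (measurableTypeR R)]
    (fun t => (\1_(sublevel A a) t : R)%:E).
  exact/measurable_EFinP/measurable_indic.
have mZ (k : R) (g : n.-tuple (measurableTypeR R) -> R) :
    measurable_fun setT (fun t => (g t)%:E) ->
    measurable_fun setT (fun t => k%:E * (g t)%:E)%E.
  by move=> /measurable_EFinP mg; apply/measurable_EFinP/measurable_funM.
have Z0 (k : R) (g : n.-tuple (measurableTypeR R) -> R) : 0 <= k ->
    (forall t, 0 <= g t) -> forall t, setT t -> (0 <= k%:E * (g t)%:E)%E.
  by move=> k0 g0 t _; rewrite -EFinM lee_fin mulr_ge0.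
have c00 : 0 <= c0 by exact: expR_ge0.
have c10 : 0 <= c1 by exact: expR_ge0.
have c20 : 0 <= c2 by exact: expR_ge0.
rewrite -(ge0_integralZl_EFin _ measurableT _ mI c00)//.
rewrite -(ge0_integralZl_EFin _ measurableT (Ew0 s1) (mEw s1) c10).
rewrite -(ge0_integralZl_EFin _ measurableT (Ew0 s2) (mEw s2) c20).
rewrite -ge0_integralD//; first last.
- by apply: mZ; exact: mEw.
- exact: Z0.
- by apply: mZ; exact: mI.
- exact: Z0.
rewrite -ge0_integralD//; first last.
- by apply: mZ; exact: mEw.
- exact: Z0.
- by apply: emeasurable_funD; [by apply: mZ; exact: mI|by apply: mZ; exact: mEw].
- by move=> t _; rewrite -!EFinM -EFinD lee_fin addr_ge0 ?mulr_ge0.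
apply: ge0_le_integral => //.
- exact: Ew0.
- apply: emeasurable_funD; last by apply: mZ; exact: mEw.
  by apply: emeasurable_funD; apply: mZ; [exact: mI|exact: mEw].
- move=> t _; rewrite -!EFinM -!EFinD lee_fin !prod_weight.
have := chernoff_pointwise (\sum_(i < n) excess A (tnth t i) ^+ 2) (n%:R * a)
  (n%:R * b) (_ : 0 <= s ^- 2) (_ : s1 ^- 2 <= s ^- 2) (_ : s ^- 2 <= s2 ^- 2).
rewrite indicE mem_setE /c0 /c1 /c2; apply.
- by rewrite invr_ge0 exprn_ge0// ltW.
- by rewrite lef_pV2 ?posrE ?exprn_gt0// lerXn2r// nnegrE ltW.
- by rewrite lef_pV2 ?posrE ?exprn_gt0// lerXn2r// nnegrE ltW.
Qed.

End volume_bound.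

(** * Choice of the scale and the lower bound on [ell] *)

Section tilting.
Context {R : realType}.
Implicit Types A s a b m e : R.

(* The equation says that the normalized weight at scale [s] gives [excess A] second
   moment [m]. *)
Lemma exists_scale A m : 0 <= A -> 0 < m ->
  exists s, [/\ 0 < s, 2 * m <= s ^+ 2 &
    Num.sqrt pi * s ^+ 3 = 2 * m * weight_mass A s].
Proof.
move=> A0 m0; set k := Num.sqrt (pi : R).
have k1 : 1 <= k by rewrite -[leLHS]sqrtr1 ler_wsqrtr// (le_trans _ (pi_ge2 R))// ler1n.
pose p : {poly R} := k *: 'X^3 - (2 * m * k) *: 'X - (4 * m * A)%:P.
have pE x : p.[x] = k * x ^+ 3 - 2 * m * k * x - 4 * m * A by rewrite !hornerE.
have m2 : 0 < 2 * m by rewrite mulr_gt0.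
(* The root is sought from [s0] upwards, which yields [2 * m <= s ^+ 2]. There [p] equals
   [- 4 * m * A], and [S] is large enough to make [p] nonnegative. *)
pose s0 := Num.sqrt (2 * m); pose S := 1 + 2 * m + 4 * m * A.
have s0E : s0 ^+ 2 = 2 * m by rewrite sqr_sqrtr// ltW.
have s00 : 0 < s0 by rewrite sqrtr_gt0.
have mA : 0 <= m * A by rewrite mulr_ge0// ltW.
have S1 : 1 <= S by rewrite /S; lra.
have s0S : s0 <= S by rewrite /S; nra.
have [|x] := @poly_ivt R p s0 S s0S.
  rewrite !pE; apply/andP; split.
    rewrite (_ : k * s0 ^+ 3 = 2 * m * k * s0); last by rewrite exprSr s0E; ring.
    by rewrite subrr sub0r oppr_le0; lra.
  have -> : k * S ^+ 3 - 2 * m * k * S - 4 * m * A =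
     k * (S * (S ^+ 2 - 2 * m)) - 4 * m * A by ring.
  have h1 : S <= S ^+ 2 by rewrite expr2 ler_peMr// (le_trans ler01).
  have h2 : 1 + 4 * m * A <= S ^+ 2 - 2 * m by move: h1; rewrite {1}/S; lra.
  have h3 : 1 + 4 * m * A <= S * (S ^+ 2 - 2 * m) by nra.
  by nra.
move=> /andP[s0x xS] /rootP; rewrite pE => px.
have x0 : 0 < x by exact: lt_le_trans s0x.
exists x; split => //.
  by rewrite -s0E lerXn2r// nnegrE ltW.
by rewrite /weight_mass -/k; lra.
Qed.

Lemma near_expR_natM_le (r c : R) : r < 0 -> 0 < c ->
  \forall n \near \oo, expR (n%:R * r) <= c.
Proof.
move=> r0 c0.
have h : `|expR r| < 1 by rewrite ger0_norm ?expR_ge0// expR_lt1.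
have /cvgr_lt/(_ c c0) H := cvg_expr h.
apply: filterS H => n.
by rewrite /GRing.exp expRM_natl => /ltW.
Qed.

(* [y] is the relative change of [weight_mass A s] when [s] is replaced by [s1] (and [- y]
   for [s2]), when [s] is the scale of [exists_scale]. *)
Lemma chernoff_rates_lt0 (m e s : R) : 0 < m -> 0 < e -> e < 1 -> 0 < s ->
  let s1 := s * (1 + e / 2) in let s2 := s * (1 - e / 2) in
  let y := m * e / s ^+ 2 in
  y - (s ^- 2 - s1 ^- 2) * (m * (1 + e)) < 0 /\
  - y + (s2 ^- 2 - s ^- 2) * (m * (1 - e)) < 0.
Proof.
move=> m0 e0 e1 s0 s1 s2 y.
have d1 : 0 < 1 + e / 2 by lra.
have d2 : 0 < 1 - e / 2 by lra.
have c0 : 0 < m * (e / 2) ^+ 2 / s ^+ 2.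
  by rewrite divr_gt0 ?mulr_gt0 ?exprn_gt0// divr_gt0.
(* The terms of first order in [e] cancel, leaving exactly [- m * (e / 2) ^+ 2 / s ^+ 2] divided by
   the square of [1 + e / 2], respectively [1 - e / 2]. *)
split.
  rewrite (_ : _ - _ = - (m * (e / 2) ^+ 2 / s ^+ 2 / (1 + e / 2) ^+ 2)).
    by rewrite oppr_lt0 divr_gt0 ?exprn_gt0.
  by rewrite /y /s1; field; apply/andP; split; rewrite gt_eqF//; lra.
rewrite (_ : _ + _ = - (m * (e / 2) ^+ 2 / s ^+ 2 / (1 - e / 2) ^+ 2)).
  by rewrite oppr_lt0 divr_gt0 ?exprn_gt0.
by rewrite /y /s2; field; apply/andP; split; rewrite gt_eqF//; lra.
Qed.

(** In [chernoff_volume] with scales [s * (1 + e / 2)] and [s * (1 - e / 2)], both tail terms are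
    exponentially small against [Z ^+ n]; the loss [- e] in the exponent absorbs the remaining
    constant factor. *)
Lemma sublevel_volume_ge A m e s : 0 <= A -> 0 < m -> 0 < e -> e < 1 -> 0 < s ->
  Num.sqrt pi * s ^+ 3 = 2 * m * weight_mass A s ->
  \forall n \near \oo,
    ((expR (n%:R * (ln (weight_mass A s) + m * (1 - e) / s ^+ 2 - e)))%:E <=
     lebesgue_tuple n (sublevel A (m * (1 + e))))%E.
Proof.
move=> A0 m0 e0 e1 s0 sE; have Z0 := weight_mass_gt0 A0 s0.
set Z := weight_mass A s in sE Z0 *.
set a := m * (1 + e); set b := m * (1 - e).
have d1 : 0 < 1 + e / 2 by lra.
have d2 : 0 < 1 - e / 2 by lra.
pose s1 := s * (1 + e / 2); pose s2 := s * (1 - e / 2).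
have s10 : 0 < s1 by exact: mulr_gt0.
have s20 : 0 < s2 by exact: mulr_gt0.
have ss1 : s <= s1 by rewrite ler_peMr ?ltW//; lra.
have s2s : s2 <= s by rewrite ler_piMr ?ltW//; lra.
pose y := m * e / s ^+ 2.
have [r1 r2] := chernoff_rates_lt0 m0 e0 e1 s0.
rewrite -/s1 -/s2 -/y -/a -/b in r1 r2.
(* By affinity, rescaling by [1 + e / 2] adds the left side to the mass; [sE] makes this the
   fraction [y] of [Z]. *)
have yE : s * Num.sqrt pi * (e / 2) = Z * y.
  rewrite /y (_ : s * _ * _ = Num.sqrt pi * s ^+ 3 * (e / 2 / s ^+ 2)).
    by rewrite sE; field; rewrite gt_eqF.
  by field; rewrite gt_eqF.
have Z1 : weight_mass A s1 <= Z * expR y.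
  rewrite (_ : weight_mass A s1 = Z * (1 + y)).
    by rewrite ler_pM2l// expR_ge1Dx.
  by rewrite mulrDr -yE /Z /weight_mass /s1; ring.
have Z2 : weight_mass A s2 <= Z * expR (- y).
  rewrite (_ : weight_mass A s2 = Z * (1 - y)).
    by rewrite ler_pM2l// expR_ge1Dx.
  by rewrite mulrBr -yE /Z /weight_mass /s2; ring.
(* Each tail takes at most a third of [Z ^+ n], so the main term keeps a third, which exceeds
   [Z ^+ n * expR (- n * e)]. *)
have third : 0 < 3^-1 :> R by rewrite invr_gt0.
have Ne : - e < 0 by rewrite oppr_lt0.
have H1 := near_expR_natM_le r1 third.
have H2 := near_expR_natM_le r2 third.
have H3 := near_expR_natM_le Ne third.
near=> n.
have E1 : expR (n%:R * (y - (s ^- 2 - s1 ^- 2) * a)) <= 3^-1 by near: n.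
have E2 : expR (n%:R * (- y + (s2 ^- 2 - s ^- 2) * b)) <= 3^-1 by near: n.
have E3 : expR (n%:R * - e) <= 3^-1 by near: n.
have := chernoff_volume n a b A0 s20 s2s ss1; rewrite -/Z.
have V0 : (0 <= lebesgue_tuple n (sublevel A a))%E by exact: measure_ge0.
move: V0; case: (lebesgue_tuple n _) => [v| |//]; last by move=> _ _; rewrite leey.
rewrite !lee_fin => v0.
have T1 : expR (- ((s ^- 2 - s1 ^- 2) * (n%:R * a))) * weight_mass A s1 ^+ n <=
    Z ^+ n * 3^-1.
  apply: (@le_trans _ _ (expR (- ((s ^- 2 - s1 ^- 2) * (n%:R * a))) * (Z * expR y) ^+ n)).
    rewrite ler_pM2l ?expR_gt0//; apply: lerXn2r => //; rewrite nnegrE ltW//.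
      exact: weight_mass_gt0.
    by rewrite mulr_gt0 ?expR_gt0.
  rewrite [(Z * _) ^+ n]exprMn [leLHS]mulrCA ler_pM2l ?exprn_gt0// -expRM_natl -expRD.
  apply: le_trans E1; rewrite ler_expR le_eqVlt; apply/orP; left; apply/eqP; ring.
have T2 : expR ((s2 ^- 2 - s ^- 2) * (n%:R * b)) * weight_mass A s2 ^+ n <=
    Z ^+ n * 3^-1.
  apply: (@le_trans _ _ (expR ((s2 ^- 2 - s ^- 2) * (n%:R * b)) * (Z * expR (- y)) ^+ n)).
    rewrite ler_pM2l ?expR_gt0//; apply: lerXn2r => //; rewrite nnegrE ltW//.
      exact: weight_mass_gt0.
    by rewrite mulr_gt0 ?expR_gt0.
  rewrite [(Z * _) ^+ n]exprMn [leLHS]mulrCA ler_pM2l ?exprn_gt0// -expRM_natl -expRD.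
  apply: le_trans E2; rewrite ler_expR le_eqVlt; apply/orP; left; apply/eqP; ring.
move=> C.
have T3 : Z ^+ n * expR (n%:R * - e) <= Z ^+ n * 3^-1 by rewrite ler_pM2l ?exprn_gt0.
have {}C : Z ^+ n * expR (n%:R * - e) <= expR (- (s ^- 2 * (n%:R * b))) * v by lra.
rewrite -(@ler_pM2l _ (expR (- (s ^- 2 * (n%:R * b))))) ?expR_gt0//.
apply: le_trans C; rewrite -[X in _ <= X ^+ _ * _]lnK ?posrE// -expRM_natl -!expRD.
by rewrite ler_expR le_eqVlt; apply/orP; left; apply/eqP; ring.
Unshelve. all: by end_near. Qed.

Lemma limn_esup_ge (u : (\bar R)^nat) (l : \bar R) :
  (\forall n \near \oo, (l <= u n)%E) -> (l <= limn_esup u)%E.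
Proof.
move=> lu; rewrite limn_esup_lim; apply: lime_ge; first exact: is_cvg_esups.
apply: filterS lu => n ln; apply: le_trans ln _.
by apply: ereal_sup_ubound; exists n => /=.
Qed.

Lemma ell_lower_bound A m e s : 0 <= A -> 0 < m -> 0 < e -> e < 1 -> 0 < s ->
  Num.sqrt pi * s ^+ 3 = 2 * m * weight_mass A s ->
  ((ln (weight_mass A s) + m * (1 - e) / s ^+ 2 - e)%:E <= ell A (m * (1 + e)))%E.
Proof.
move=> A0 m0 e0 e1 s0 sE; apply: limn_esup_ge.
have Vn := sublevel_volume_ge A0 m0 e0 e1 s0 sE.
near=> n.
(* Index 0 is excluded so that the factor [n%:R^-1] can be cleared; exponentiating then leaves a
   bound on the volume. *)
have n0 : (0 < n)%N by near: n; exact: nbhs_infty_gt.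
rewrite /Vol minkowski_cube_eballE//; last by rewrite mulr_ge0; lra.
rewrite -lee_pdivrMl ?invr_gt0 ?ltr0n// invrK -EFinM.
rewrite -[leLHS]expeRK lee_lne ?in_itv/= ?leey ?lee_fin ?expR_ge0 ?measure_ge0//.
by near: n.
Unshelve. all: by end_near. Qed.

End tilting.

(** For the case [nu = 0], where no scale with positive second moment is available: the sublevel set
    contains the cube, of volume [(2 * A) ^+ n]. *)
Lemma ell_cube_ge (R : realType) (A : R) : 0 < A ->
  ((ln (2 * A))%:E <= ell A 0)%E.
Proof.
move=> A0; apply: limn_esup_ge; near=> n.
have n0 : (0 < n)%N by near: n; exact: nbhs_infty_gt.
rewrite /Vol minkowski_cube_eballE ?(ltW A0)//.
rewrite -lee_pdivrMl ?invr_gt0 ?ltr0n// invrK -EFinM.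
rewrite -[leLHS]expeRK lee_lne ?in_itv/= ?leey ?lee_fin ?expR_ge0 ?measure_ge0//.
rewrite expRM_natl lnK ?posrE ?mulr_gt0//.
pose I (i : 'I_n) : set (measurableTypeR R) := [set` `[- A, A]].
have -> : ((2 * A) ^+ n)%:E = lebesgue_tuple n [set t | forall i, I i (tnth t i)].
  rewrite lebesgue_tuple_box; last by move=> i; exact: measurable_itv.
  have IE i : @lebesgue_measure R (I i) = (2 * A)%:E.
    rewrite lebesgue_measure_itv/= lte_fin; case: ltP => h; last by congr EFin; lra.
    by rewrite -EFinD; congr EFin; ring.
  by rewrite (eq_bigr (fun=> (2 * A)%:E)) ?prodEFin ?prodr_const ?card_ord.
apply: le_measure; rewrite ?inE.
- rewrite (_ : [set t | _] = \bigcap_(i in [set: 'I_n]) (fun t => tnth t i) @^-1` I i).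
    apply: fin_bigcap_measurable => // i _.
    rewrite -[X in measurable X]setTI; apply: measurable_tnth => //.
    exact: measurable_itv.
  by apply/seteqP; split => t /= h i; [move=> _|]; exact: h.
- exact: measurable_sublevel.
- move=> t /= tI; rewrite /sublevel/= mulr0 big1// => i _.
  have := tI i; rewrite /I/= in_itv/= -ler_norml => h.
  by rewrite /excess max_r ?expr0n//= subr_le0.
Unshelve. all: by end_near. Qed.

(** * Upper bound on the entropy of the sum *)

Section entropy_bound.
Context {d} {T : measurableType d} {R : realType} (P : probability T R).
Variables (A nu : R) (X Z : {RV P >-> R}).
Hypotheses (A0 : 0 <= A) (XA : {ae P, forall w, `|X w| <= A})
  (Znu : ('V_P[Z] <= nu%:E)%E).

(** Almost surely the excess of [X + Z - c], with [c] the mean of [Z], is at most [|Z - c|], so its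
    second moment is at most the variance of [Z]. *)
Lemma diff_entropy_le s : 0 < s ->
  (diff_entropy (X + Z : {RV P >-> R})%R <=
   (ln (weight_mass A s) + nu / s ^+ 2)%:E)%E.
Proof.
move=> s0; rewrite /diff_entropy; case: pselect => [h|_]; last exact: leNye.
case: cid => f /= fY.
(* The centre is the real constant that the definition of variance subtracts. *)
apply: (@entropy_le_weight _ _ _ _ _ _ _ _ (fine 'E_P[Z]) _ A0 s0 fY).
apply: le_trans Znu; rewrite /variance covariance.unlock expectation.unlock.
set c := fine _.
have mZc : measurable_fun [set: T] (Z \- cst c)%R by exact: measurable_funB.
apply: ae_ge0_le_integral => //.
- by move=> w _; rewrite lee_fin sqr_ge0.
- apply/measurable_EFinP/measurable_funX.
  apply: (measurableT_comp (measurable_excess A)).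
  by apply: measurable_funB => //; exact: measurable_funD.
- by move=> w _; rewrite lee_fin; exact: sqr_ge0.
- by apply/measurable_EFinP; exact: measurable_funM.
apply: filterS XA => w XAw _; rewrite lee_fin.
rewrite -[leRHS]/((Z w - c) ^+ 2) -[leRHS]real_normK ?num_real//.
rewrite lerXn2r ?nnegrE ?excess_ge0//.
rewrite (_ : _ - c = X w + (Z w - c)); last by rewrite addrA.
exact: excess_le_norm.
Qed.

End entropy_bound.

(** * Comparison of the two bounds *)

Theorem theorem7p7 (R : realType) (d : measure_display) (T : measurableType d)
    (P : probability T R) (A nu : R) (X Z : {RV P >-> R})
    (hA : 0 <= A) (hnu : 0 <= nu)
    (hX : {ae P, forall w, `|X w| <= A})
    (hZ : ('V_P[Z] <= nu%:E)%E) :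
  (diff_entropy (X + Z : {RV P >-> R})%R <= ell A nu)%E.
Proof.
have H := diff_entropy_le hA hX hZ.
have [nu0|nu0] := ltP 0 nu; last first.
  have {}nu0 : nu = 0 by apply/eqP; rewrite eq_le nu0.
  rewrite {}nu0 in H *.
  have k0 : 0 < Num.sqrt (pi : R) by rewrite sqrtr_gt0 pi_gt0.
  have [A0|A0] := ltP 0 A.
    apply: le_trans (ell_cube_ge A0); apply/lee_addgt0Pr => e e0.
    (* Chosen so that the tails add the fraction [e] to the mass [2 * A]; then [ln (1 + e) <= e]. *)
    pose s := 2 * A * e / Num.sqrt pi.
    have s0 : 0 < s by rewrite divr_gt0// !mulr_gt0.
    apply: le_trans (H _ s0) _; rewrite mul0r addr0 -EFinD lee_fin.
    have -> : weight_mass A s = 2 * A * (1 + e).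
      by rewrite /weight_mass /s divfK ?gt_eqF//; ring.
    rewrite lnM ?posrE ?mulr_gt0 ?addr_gt0// lerD2l le_ln1Dx//.
    by rewrite (lt_trans _ e0)// ltrN10.
  have {}A0 : A = 0 by apply/eqP; rewrite eq_le A0.
  suff -> : diff_entropy (X + Z : {RV P >-> R})%R = -oo%E by rewrite leNye.
  apply/eqP; rewrite -leeNy_eq leNgt; apply/negP => hNy.
  (* With [A = nu = 0] the upper bound is [ln (s * Num.sqrt pi)], which this [s] makes equal to the
     arbitrary real [M]. *)
  have hle M : (diff_entropy (X + Z : {RV P >-> R})%R <= M%:E)%E.
    have s0 : 0 < expR M / Num.sqrt pi by rewrite divr_gt0// expR_gt0.
    apply: le_trans (H _ s0) _.
    by rewrite mul0r addr0 /weight_mass A0 mulr0 add0r divfK ?gt_eqF// expRK.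
  move: hNy hle; case: diff_entropy => [r _|_|//] /=.
    by move=> /(_ (r - 1)); rewrite lee_fin; lra.
  by move=> /(_ 0); rewrite leye_eq.
apply/lee_addgt0Pr => e' e'0.
(* One [e] pays for the loss in [ell_lower_bound], the other for the gap between the second-moment
   terms. *)
pose e := Num.min (e' / 2) (1 / 2).
have e0 : 0 < e by rewrite lt_min !divr_gt0.
have e1 : e < 1 by rewrite gt_min; apply/orP; right; lra.
have ee' : e + e <= e'.
  have : e <= e' / 2 by rewrite ge_min lexx.
  by lra.
pose m := nu / (1 + e).
have e10 : 0 < 1 + e by rewrite addr_gt0.
have m0 : 0 < m by rewrite divr_gt0.
have nuE : nu = m * (1 + e) by rewrite divfK// gt_eqF.
have [s [s0 s2 sE]] := exists_scale hA m0.
have L := ell_lower_bound hA m0 e0 e1 s0 sE.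
rewrite -nuE in L.
apply: le_trans (H _ s0) _; apply: le_trans (leeD2r e'%:E L).
rewrite -EFinD lee_fin.
have s20 : 0 < s ^+ 2 by rewrite exprn_gt0.
(* The difference is [2 * m * e / s ^+ 2], at most [e] because [2 * m <= s ^+ 2]. *)
have : nu / s ^+ 2 - m * (1 - e) / s ^+ 2 <= e.
  rewrite -mulrBl ler_pdivrMr// nuE.
  by nra.
by lra.
Qed.
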